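(* Fix constants $c_1,\dots,c_N\ge 0$. For each $M\ge1$ let $\mathbf{a}^{(M)}\in\mathbb{C}^N$ be any gain vector with $|a_i^{(M)}|^2=c_i/M$ for all $i$, and let $\mathbf{H}_M$ be the $M\times N$ channel matrix. Then, almost surely, $$\lim_{M\to\infty} g_{\mathbf{H}_M}(\mathbf{a}^{(M)})=\sum_{i=1}^N\frac{c_i}{\sigma_n^2 d_i^{\alpha}+\sigma_{v,i}^2 c_i}.$$ Consequently, for fixed $\epsilon\in(0,1]$, the probability of detection at false-alarm level $\epsilon$, namely $\epsilon^{1/(1+\sigma_\theta^2 g_{\mathbf{H}_M}(\mathbf{a}^{(M)}))}$, converges almost surely to the constant $\epsilon^{1/(1+\sigma_\theta^2\sum_i c_i/(\sigma_n^2 d_i^\alpha+\sigma_{v,i}^2c_i))}$; i.e. reducing every $|a_i|^2$ by a factor $1/M$ as $M\to\infty$ asymptotically preserves detection performance.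
   Context: Constants: $\sigma_\theta^2,\sigma_n^2>0$, $\sigma_{v,i}^2>0$, distances $d_i>0$, path-loss exponent $\alpha>0$, $i=1,\dots,N$. Channel model: let $(\tilde h_{mi})_{m\ge1,\,1\le i\le N}$ be i.i.d. $\mathcal{CN}(0,1)$ random variables, and let $\mathbf{H}_M\in\mathbb{C}^{M\times N}$ have entries $[\mathbf{H}_M]_{mi}=\tilde h_{mi}/\sqrt{d_i^{\alpha}}$, $m\le M$. For $\mathbf{a}\in\mathbb{C}^N$, $\mathbf{D}=\mathrm{diag}\{a_1,\dots,a_N\}$, $\mathbf{V}=\mathrm{diag}\{\sigma_{v,1}^2,\dots,\sigma_{v,N}^2\}$, and $$g_{\mathbf{H}}(\mathbf{a})=\mathbf{a}^H\mathbf{H}^H\big(\mathbf{H}\mathbf{D}\mathbf{V}\mathbf{D}^H\mathbf{H}^H+\sigma_n^2\mathbf{I}_M\big)^{-1}\mathbf{H}\mathbf{a}.$$ (This $g$ is the quantity governing the Neyman–Pearson detector for the model $\mathcal{H}_0:\mathbf{y}=\mathbf{H}\mathbf{D}\mathbf{v}+\mathbf{n}$, $\mathcal{H}_1:\mathbf{y}=\mathbf{H}\mathbf{a}\theta+\mathbf{H}\mathbf{D}\mathbf{v}+\mathbf{n}$ with $\theta\sim\mathcal{CN}(0,\sigma_\theta^2)$, $\mathbf{v}\sim\mathcal{CN}(\mathbf{0},\mathbf{V})$, $\mathbf{n}\sim\mathcal{CN}(\mathbf{0},\sigma_n^2\mathbf{I}_M)$ independent, whose detection probability at false-alarm probability $\epsilon$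 equals $\epsilon^{1/(1+\sigma_\theta^2 g)}$.) *)

(* Defs.v *)
From HB Require Import structures.
From mathcomp Require Import all_boot all_order all_algebra.
From mathcomp Require Import all_classical all_reals all_analysis.
From mathcomp Require Import complex.
Set Implicit Arguments. Unset Strict Implicit. Unset Printing Implicit Defensive.
Import Order.TTheory GRing.Theory Num.Theory.
Local Open Scope ring_scope.
Local Open Scope classical_set_scope.

Definition mutually_independent d (T : measurableType d) (R : realType)
  (P : probability T R) (I : eqType) (X : I -> T -> R) : Prop :=
  (forall i, measurable_fun setT (X i)) /\
  forall (F : seq I), uniq F -> forall B : I -> set R,
    (forall i, measurable (B i)) ->
    P (\bigcap_(i in [set` F]) (X i @^-1` B i)) = (\prod_(i <- F) P (X i @^-1` B i))%E.

Definition has_law_normal_half d (T : measurableType d) (R : realType)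
  (P : probability T R) (X : T -> R) : Prop :=
  forall B : set R, measurable B ->
    P (X @^-1` B) = normal_prob 0 (Num.sqrt (2^-1 : R)) B.

Definition ctrmx (R : rcfType) m n (A : 'M[R[i]]_(m, n)) : 'M[R[i]]_(n, m) :=
  (map_mx (@conjc R) A)^T.

(* Channel matrix H_M (M rows), [H]_{mi} = htilde_{mi} / sqrt(d_i^alpha),
   htilde_{mi} = hr m i + i * hi m i (row index m = 0..M-1 stands for m = 1..M). *)
Definition chanH (R : realType) (N M : nat) (dist : 'I_N -> R) (alpha : R)
  (hr hi : nat -> 'I_N -> R) : 'M[R[i]]_(M, N) :=
  \matrix_(m < M, k < N)
    ((Complex (hr m k) (hi m k)) * ((Num.sqrt (dist k `^ alpha))^-1)%:C)%C.

Definition gH (R : realType) (N M : nat) (sigv : 'I_N -> R) (sign2 : R)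
  (H : 'M[R[i]]_(M, N)) (a : 'cV[R[i]]_N) : R[i] :=
  let D := diag_mx a^T in
  let V := diag_mx (\row_k (sigv k)%:C%C) in
  (ctrmx a *m ctrmx H *m
     invmx (H *m D *m V *m ctrmx D *m ctrmx H + (sign2%:C)%C%:M) *m H *m a) 0 0.

Definition cabs (R : rcfType) (z : R[i]) : R := complex.Re `|z|.

(* Main.v *)
(** With W = H^H H D V D^H + s I, the identity W H^H = H^H (H D V D^H H^H + s I)
    moves the inverse from size M to size N:
    g = M a^H (G C + s I)^-1 G a, where G = H^H H / M is the Gram matrix and
    C = M D V D^H = diag(sigma_v^2 c) does not depend on M.  By the strong law of
    large numbers G tends almost surely to diag(d^-alpha), so by continuity of
    the inverse (G C + s I)^-1 G tends to a diagonal matrix, in which only the moduli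
    of the a_i matter.  The entries of G are averages of products of independent
    Gaussian variables: these products, once centered, are pairwise
    uncorrelated with equal variances, and for such a sequence the law of
    large numbers holds by summing the second moments along the squares n^2 and
    over the gaps between consecutive squares. *)
Require Import Defs.
From HB Require Import structures.
From mathcomp Require Import all_boot all_order all_algebra.
From mathcomp Require Import all_classical all_reals all_analysis.
From mathcomp Require Import measurable_realfun complex ring lra zify.
Set Implicit Arguments.
Unset Strict Implicit.
Unset Printing Implicit Defensive.
Import Order.TTheory GRing.Theory Num.Theory.
Import numFieldNormedType.Exports.
Local Open Scope ring_scope.
Local Open Scope classical_set_scope.

(** * Integrals against a density and Gaussian moments *)

Section integral_density.
Import HBNNSimple.

(** The hypothesis on [nu] is the claim for indicators: [nu] is the image under [X] of the measure
    with density [W]. Linearity gives simple functions, and monotone convergence on both sides gives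
    any nonnegative [f]. *)
Lemma ge0_integral_density d d' (T : measurableType d) (U : measurableType d')
    (R : realType) (m : {measure set T -> \bar R}) (nu : {measure set U -> \bar R})
    (X : T -> U) (W : T -> R) (f : U -> R) :
  measurable_fun setT X -> measurable_fun setT W -> (forall x, 0 <= W x) ->
  (forall B, measurable B -> nu B = \int[m]_x (\1_B (X x) * W x)%:E)%E ->
  measurable_fun setT f -> (forall y, 0 <= f y) ->
  (\int[nu]_y (f y)%:E = \int[m]_x (f (X x) * W x)%:E)%E.
Proof.
move=> mX mW W0 nuE mf f0.
have mEf : measurable_fun setT (EFin \o f) by exact/measurable_EFinP.
pose h := nnsfun_approx measurableT mEf.
have mh n : measurable_fun setT (fun x => h n (X x)).
  by apply: measurableT_comp.
have hf y : EFin \o h^~ y @ \oo --> (f y)%:E.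
  by apply: cvg_nnsfun_approx => // z _; rewrite lee_fin.
have -> : (\int[nu]_y (f y)%:E = limn (fun n => \int[nu]_y (h n y)%:E))%E.
  rewrite -monotone_convergence//.
  - by apply: eq_integral => y _; apply/esym/cvg_lim => //; exact: hf.
  - by move=> n; exact/measurable_EFinP/measurable_funP.
  - by move=> n y _; rewrite lee_fin.
  - by move=> y _ a b ab; rewrite lee_fin; exact/lefP/nd_nnsfun_approx.
have -> : (\int[m]_x (f (X x) * W x)%:E =
    limn (fun n => \int[m]_x (h n (X x) * W x)%:E))%E.
  rewrite -monotone_convergence//.
  - apply: eq_integral => x _; apply/esym/cvg_lim => //.
    under eq_fun do rewrite EFinM.
    by rewrite EFinM; apply: cvgeZr => //; exact: hf.
  - by move=> n; apply/measurable_EFinP/measurable_funM.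
  - by move=> n x _; rewrite lee_fin mulr_ge0.
  - move=> x _ a b ab; rewrite lee_fin ler_wpM2r//; exact/lefP/nd_nnsfun_approx.
congr (limn _); apply/funext => n.
transitivity (\int[nu]_y (\sum_(r \in range (h n)) (r * \1_(h n @^-1` [set r]) y)%:E))%E.
  by apply: eq_integral => y _; rewrite /= fimfunE -fsumEFin.
rewrite ge0_integral_fsum//; last 2 first.
- by move=> r; exact/measurable_EFinP/measurable_funM.
- by move=> r y _; exact: nnfun_muleindic_ge0.
transitivity (\int[m]_x (\sum_(r \in range (h n))
    ((r * \1_(h n @^-1` [set r]) (X x)) * W x)%:E))%E; last first.
  apply: eq_integral => x _; under eq_fsbigr do rewrite EFinM.
  rewrite -ge0_mule_fsuml; last first.
    by move=> r; exact: nnfun_muleindic_ge0.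
  by rewrite fsumEFin// -(fimfunE _ (X x)) EFinM.
rewrite ge0_integral_fsum//; last 2 first.
- move=> r; apply/measurable_EFinP.
  by do 2?apply: measurable_funM => //; exact: measurableT_comp.
- by move=> r y _; rewrite EFinM mule_ge0 ?lee_fin//; exact: nnfun_muleindic_ge0.
apply: eq_fsbigr => r /[!inE] -[y0 _ hr].
have r0 : 0 <= r by rewrite -hr.
have mI : measurable_fun setT (fun x => \1_(h n @^-1` [set r]) (X x) : R).
  by apply: measurableT_comp.
under eq_integral do rewrite EFinM.
rewrite ge0_integralZl//; last exact/measurable_EFinP.
rewrite integral_indic// setIT nuE//.
under [RHS]eq_integral do rewrite -mulrA EFinM.
rewrite ge0_integralZl//.
- exact/measurable_EFinP/measurable_funM.
- by move=> x _; rewrite lee_fin mulr_ge0.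
Qed.

End integral_density.

(** This bound and the next three share the majorant 1 + x^4, so that one integrability result
    covers every Gaussian moment needed. The squares supplied to [lra] are the certificates. *)
Lemma norm_le_1Dx4 (R : realType) (x : R) : `|x| <= 1 + x ^+ 4.
Proof.
have := sqr_ge0 (x ^+ 2 - 1); have := sqr_ge0 (x - 1); have := sqr_ge0 (x + 1).
have := sqr_ge0 x; have := sqr_ge0 (x ^+ 2).
by rewrite ler_norml => *; apply/andP; split; lra.
Qed.

Lemma sqr_le_1Dx4 (R : realType) (x : R) : `|x ^+ 2| <= 1 + x ^+ 4.
Proof.
have := sqr_ge0 (x ^+ 2 - 1); have := sqr_ge0 x; have := sqr_ge0 (x ^+ 2).
by rewrite ler_norml => *; apply/andP; split; lra.
Qed.

Lemma centered_sqr_le_1Dx4 (R : realType) (x : R) : `|x ^+ 2 - 2^-1| <= 1 + x ^+ 4.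
Proof.
have := sqr_ge0 (x ^+ 2 - 1); have := sqr_ge0 x; have := sqr_ge0 (x ^+ 2).
by rewrite ler_norml => *; apply/andP; split; lra.
Qed.

Lemma centered_sqr_sqr_le_1Dx4 (R : realType) (x : R) : `|(x ^+ 2 - 2^-1) ^+ 2| <= 1 + x ^+ 4.
Proof.
have := sqr_ge0 (x ^+ 2 - 2^-1); have := sqr_ge0 x; have := sqr_ge0 (x ^+ 2).
by rewrite ler_norml => *; apply/andP; split; lra.
Qed.

(** On [-n, n] the integral is F(n) - F(-n), which vanishes in the limit; dominated convergence,
    with |f| as majorant, identifies the same limit with the integral over the line. *)
Lemma integral_derive_eq0 (R : realType) (F f : R -> R) :
  (forall x : R, is_derive x 1 F (f x)) -> continuous f ->
  lebesgue_measure.-integrable setT (EFin \o f) ->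
  (F n%:R - F (- n%:R)) @[n --> \oo] --> (0 : R) ->
  (\int[lebesgue_measure]_x (f x)%:E = 0)%E.
Proof.
move=> dF cf intf F0.
have mE : measurable_fun [set: measurableTypeR R] (EFin \o f) by exact: measurable_int intf.
pose D n : set (measurableTypeR R) := `[(- n%:R), n%:R]%classic.
have lim1 : (\int[lebesgue_measure]_x ((EFin \o f) \_ (D n)) x)%E @[n --> \oo] -->
    (\int[lebesgue_measure]_x (f x)%:E)%E.
  have fin (x : measurableTypeR R) : setT x -> (abse \o (EFin \o f)) x \is a fin_num by [].
  refine (dominated_cvg measurableT _ _ fin (integrable_abse intf) _).
  - move=> n; apply/(measurable_restrict _ _ _).1 => //; first exact: measurable_itv.
    by rewrite setTI; apply: measurable_funTS.
  - move=> x _; apply: cvg_near_cst; near=> n.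
    rewrite patchE mem_set// /D/= in_itv/= -ler_norml.
    by near: n; exact: nbhs_infty_ger.
  - move=> n x _; rewrite patchE; case: ifP => // _.
    by rewrite abse0 /= lee_fin.
have lim2 : (\int[lebesgue_measure]_x ((EFin \o f) \_ (D n)) x)%E @[n --> \oo] --> (0%:E : \bar R).
  have : (F n%:R - F (- n%:R))%:E @[n --> \oo] --> (0%:E : \bar R).
    by apply: cvg_EFin => //; exact: nearW.
  apply: cvg_trans; apply: near_eq_cvg; near=> n.
  have n0 : (0 < n%:R :> R) by near: n; exact: nbhs_infty_gtr.
  rewrite -integral_mkcond /D (@continuous_FTC2 _ f F).
  - by rewrite EFinB.
  - by rewrite (lt_trans _ n0)// oppr_lt0.
  - by apply: continuous_subspaceT.
  - have dFx x : derivable F x 1 by have [] := dF x.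
    have cF x : {for x, continuous F}.
      by apply: differentiable_continuous; apply/derivable1_diffP.
    split => //.
    + exact: cvg_at_right_filter (cF _).
    + exact: cvg_at_left_filter (cF _).
  - by move=> x _; rewrite derive1E; have [_ ->] := dF x.
exact: (cvg_unique _ lim1 lim2).
Unshelve. all: by end_near. Qed.

(** * Moments of the centered normal law of variance 1/2 *)

Section gaussian_half.
Context {R : realType}.
Let mu := @lebesgue_measure R.
Let s : R := Num.sqrt 2^-1.
Let pdf : R -> R := normal_pdf 0 s.
Let k : R := normal_peak s.

Let s2 : s ^+ 2 = 2^-1. Proof. by rewrite sqr_sqrtr. Qed.

Let s0 : s != 0.
Proof. by rewrite /s sqrtr_eq0 -ltNge. Qed.

Let pdfE x : pdf x = k * expR (- x ^+ 2).
Proof.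
rewrite /pdf normal_pdfE// /normal_fun subr0 s2; congr (_ * expR _).
by field.
Qed.

Let k0 : 0 < k. Proof. exact: normal_peak_gt0. Qed.

(** The density is proportional to exp(-x^2) = exp(-x^2/2) exp(-x^2/2): one factor absorbs the
    polynomial 1 + x^4, the other is a multiple of the standard normal density. *)
Lemma integrable_normal_half (h : R -> R) : measurable_fun setT h ->
  (forall x, `|h x| <= 1 + x ^+ 4) ->
  mu.-integrable setT (fun x => (h x * normal_pdf 0 (Num.sqrt (2^-1 : R)) x)%:E).
Proof.
move=> mh hle.
(* The 8 bounds (1 + x^4) exp(-x^2/2): with y = x^2/2, exp(y) >= 1 + y^2/2 = 1 + x^4/8. The peaks
   convert one normalization into the other. *)
pose C := 8 * k / normal_peak (1 : R).
have p1 : 0 < normal_peak (1 : R) by apply: normal_peak_gt0; exact: oner_neq0.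
have intC : mu.-integrable setT (fun x => C%:E * (normal_pdf 0 1 x)%:E)%E.
  by apply: integrableZl => //; exact: integrable_normal_pdf.
apply: (le_integrable measurableT _ _ intC).
- apply/measurable_EFinP; apply: measurable_funM => //; exact: measurable_normal_pdf.
- move=> x _; rewrite -EFinM !abse_EFin lee_fin -/s -/pdf pdfE.
  rewrite normal_pdfE ?oner_neq0// /normal_fun subr0.
  have -> : C * (normal_peak 1 * expR (- x ^+ 2 / (1 ^+ 2 *+ 2))) =
     8 * k * expR (- x ^+ 2 / (1 ^+ 2 *+ 2)).
    by rewrite /C; field; rewrite gt_eqF.
  have e2 : expR (- x ^+ 2) = expR (- (x ^+ 2 / 2)) * expR (- x ^+ 2 / (1 ^+ 2 *+ 2)).
    by rewrite -expRD; congr expR; field.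
  have y0 : 0 <= x ^+ 2 / 2 by rewrite divr_ge0 ?sqr_ge0.
  have key : (1 + x ^+ 4) * expR (- (x ^+ 2 / 2)) <= 8.
    rewrite expRN ler_pdivrMr ?expR_gt0//.
    have := expR_ge1Dxn 1 y0; have -> : (2`! = 2)%N by [].

    have -> : 1 + (x ^+ 2 / 2) ^+ 2 / 2 = 1 + x ^+ 4 / 8 :> R by field.
    by lra.
  have a0 := expR_gt0 (- (x ^+ 2 / 2)).
  rewrite e2; move: (expR_gt0 (- x ^+ 2 / (1 ^+ 2 *+ 2))) key a0.
  move: (expR (- x ^+ 2 / _)) (expR (- (x ^+ 2 / 2))) => E a E0 key a0.
  have kE0 : 0 < k * E by rewrite mulr_gt0.
  rewrite normrM (@ger0_norm _ (k * _)) ?(@ger0_norm _ (8 * k * E)); last 2 first.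
    by rewrite -mulrA mulr_ge0 ?ltW.
    by rewrite !mulr_ge0 ?ltW.
  apply: (@le_trans _ _ ((1 + x ^+ 4) * (k * (a * E)))).
    by rewrite ler_wpM2r ?hle// !mulr_ge0 ?ltW.
  have -> : (1 + x ^+ 4) * (k * (a * E)) = ((1 + x ^+ 4) * a) * (k * E) by ring.
  by rewrite -[8 * k * E]mulrA ler_wpM2r// ltW.
Qed.

Let cvg_natr_gauss : (fun n : nat => n%:R * expR (- n%:R ^+ 2)) @ \oo --> (0 : R).
Proof.
have h0 : (fun n : nat => 2 * harmonic n) @ \oo --> (0 : R).
  by rewrite -(mulr0 2); apply: cvgMr; exact: cvg_harmonic.
apply: (squeeze_cvgr _ (cvg_cst 0) h0); near=> n.
rewrite mulr_ge0 ?expR_ge0//= expRN ler_pdivrMr ?expR_gt0//.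
apply: (@le_trans _ _ (2 * harmonic n * (1 + n%:R ^+ 2))); last first.
  by rewrite ler_wpM2l ?expR_ge1Dx// mulr_ge0 ?harmonic_ge0.
rewrite /harmonic/= -natr1 mulrAC ler_pdivlMr ?ltr_wpDl//.
have : 0 <= n%:R :> R by [].
by nra.
Unshelve. all: by end_near. Qed.

Let continuous_pdf : continuous pdf.
Proof. exact: continuous_normal_pdf. Qed.

Let derive_pdf (x : R) : is_derive x 1 pdf (- 2 * x * pdf x).
Proof.
rewrite (_ : pdf = fun x => k * expR (- x ^+ 2)); last by apply/funext => y; exact: pdfE.
apply: is_derive_eq; rewrite /GRing.scale/=; ring.
Qed.

(** Since [pdf] has derivative -2x [pdf], the integrand is the derivative of -[pdf]/2, which is
    even. *)
Lemma normal_half_mean :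
  (\int[mu]_x (x * normal_pdf 0 (Num.sqrt (2^-1 : R)) x)%:E = 0)%E.
Proof.
apply: (@integral_derive_eq0 _ (fun x => - 2^-1 * pdf x)).
- move=> x; rewrite -/s -/pdf; have dp := derive_pdf x; apply: is_derive_eq; rewrite /GRing.scale/=; lra.
- move=> x; apply: cvgM; first exact: cvg_id; exact: continuous_pdf.
- by apply: integrable_normal_half => [|x]; [exact: measurable_id|exact: norm_le_1Dx4].
- under eq_fun do rewrite !pdfE sqrrN subrr; exact: cvg_cst.
Qed.

(** The integrand is the derivative of -x [pdf]/2; the boundary terms decay like n exp(-n^2). *)
Lemma normal_half_variance :
  (\int[mu]_x ((x ^+ 2 - 2^-1) * normal_pdf 0 (Num.sqrt (2^-1 : R)) x)%:E = 0)%E.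
Proof.
apply: (@integral_derive_eq0 _ (fun x => - 2^-1 * (x * pdf x))).
- move=> x; rewrite -/s -/pdf; have dp := derive_pdf x; apply: is_derive_eq; rewrite /GRing.scale/=; lra.
- move=> x; apply: cvgM; last exact: continuous_pdf.
  by apply: cvgB; [exact: exprn_continuous|exact: cvg_cst].
- apply: integrable_normal_half => [|x]; last exact: centered_sqr_le_1Dx4.
  by apply: measurable_funB => //; exact: exprn_measurable.
- rewrite [X in X @ _ --> _](_ : _ = fun n => - k * (n%:R * expR (- n%:R ^+ 2))).
    by rewrite -(mulr0 (- k)); apply: cvgMr; exact: cvg_natr_gauss.
  by apply/funext => n; rewrite !pdfE sqrrN; lra.
Qed.

End gaussian_half.

(** * Expectations of functions of a variable with this law *)

Section integral_law.
Context d (T : measurableType d) (R : realType) (P : probability T R).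
Context (X : T -> R) (mX : measurable_fun setT X) (lX : has_law_normal_half P X).
Local Notation pdf := (normal_pdf 0 (Num.sqrt (2^-1 : R))).

Let mpdf : measurable_fun setT pdf. Proof. exact: measurable_normal_pdf. Qed.

(** Change of variables turns the left side into an integral against the image law, which is
    Lebesgue measure with density [pdf]; [ge0_integral_density] then applies with the identity
    map. *)
Lemma ge0_integral_normal_half (h : R -> R) : measurable_fun setT h -> (forall y, 0 <= h y) ->
  (\int[P]_w (h (X w))%:E = \int[lebesgue_measure]_x (h x * pdf x)%:E)%E.
Proof.
move=> mh h0.
pose X' : {mfun T >-> R} := HB.pack X (isMeasurableFun.Build _ _ _ _ X mX).
have mEh : measurable_fun setT (fun y => (h y)%:E) by apply/measurable_EFinP; exact: mh.
have h0' : {in setT, forall y, 0 <= (h y)%:E}%E by move=> y _; rewrite lee_fin.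
have := ge0_integral_pushforward mX P measurableT mEh h0'.
rewrite preimage_setT /comp => <-.
apply: (@ge0_integral_density _ _ _ _ _ lebesgue_measure (pushforward P X') id).
- exact: measurable_id.
- exact: mpdf.
- by move=> x; exact: normal_pdf_ge0.
- move=> B mB; rewrite /= /pushforward lX// /normal_prob integral_mkcond.
  by apply: eq_integral => x _; rewrite patchE indicE; case: ifP => _; rewrite ?mul1r ?mul0r.
- exact: mh.
- exact: h0.
Qed.

Lemma integral_normal_half (h : R -> R) : measurable_fun setT h ->
  (\int[P]_w (h (X w))%:E = \int[lebesgue_measure]_x (h x * pdf x)%:E)%E.
Proof.
move=> mh; rewrite integralE [RHS]integralE; congr (_ - _)%E.
- transitivity (\int[P]_w (Num.max (h (X w)) 0)%:E)%E.
    by apply: eq_integral => w _; rewrite funeposE -EFin_max.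
  rewrite (@ge0_integral_normal_half (fun y => Num.max (h y) 0)).
  + apply: eq_integral => x _; rewrite funeposE -EFin_max; congr (_%:E).
    by rewrite maxr_pMl ?normal_pdf_ge0// mul0r.
  + exact: measurable_maxr.
  + by move=> y; rewrite le_max lexx orbT.
- transitivity (\int[P]_w (Num.max (- h (X w)) 0)%:E)%E.
    by apply: eq_integral => w _; rewrite funenegE -EFinN -EFin_max.
  rewrite (@ge0_integral_normal_half (fun y => Num.max (- h y) 0)).
  + apply: eq_integral => x _; rewrite funenegE -EFinN -EFin_max -mulNr; congr (_%:E).
    by rewrite maxr_pMl ?normal_pdf_ge0// mul0r.
  + by apply: measurable_maxr => //; exact: measurableT_comp.
  + by move=> y; rewrite le_max lexx orbT.
Qed.

Lemma integrable_comp_normal_half (h : R -> R) : measurable_fun setT h ->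
  (forall x, `|h x| <= 1 + x ^+ 4) ->
  P.-integrable setT (fun w => (h (X w))%:E).
Proof.
move=> mh hle; apply/integrableP; split.
  by apply/measurable_EFinP; apply: measurableT_comp.
under eq_integral do rewrite abse_EFin.
rewrite (@ge0_integral_normal_half (fun y => `|h y|))//; last exact: measurableT_comp.
have /integrableP[_] := integrable_normal_half mh hle.
congr (_ < _)%E; apply: eq_integral => x _.
by rewrite abse_EFin normrM (ger0_norm (normal_pdf_ge0 _ _ _)).
Qed.

End integral_law.

(** * Products of independent variables *)

Section independent_products.
Context d (T : measurableType d) (R : realType) (P : probability T R).
Context (I : choiceType) (X : I -> T -> R).
Hypothesis indepX : mutually_independent P X.

Let mX i : measurable_fun setT (X i). Proof. by case: indepX. Qed.

(* Independence is the case F1 = [::]; the indicators are then traded one at a time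
   for arbitrary f i, the other factors acting as a density. *)
Lemma independent_integral_prod_indic (f : I -> R -> R) (e : I -> R)
    (F1 F2 : seq I) (B : I -> set R) :
  (forall i, measurable_fun setT (f i)) -> (forall i y, 0 <= f i y) ->
  (forall i, \int[P]_w (f i (X i w))%:E = (e i)%:E)%E ->
  (forall i, measurable (B i)) -> uniq (F1 ++ F2) ->
  (\int[P]_w ((\prod_(i <- F1) f i (X i w)) *
              (\prod_(i <- F2) \1_(B i) (X i w)))%:E =
   ((\prod_(i <- F1) e i) * (\prod_(i <- F2) fine (P (X i @^-1` B i))))%:E)%E.
Proof.
move=> mf f0 fe.
have e0 i : 0 <= e i.
  by rewrite -lee_fin -fe; apply: integral_ge0 => w _; rewrite lee_fin.
have mfX i : measurable_fun setT (fun w => f i (X i w)).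
  by apply: measurableT_comp.
elim: F1 F2 B => [|i F1 IH] F2 B mB /=.
  move=> uF.
  under eq_integral do rewrite big_nil mul1r.
  rewrite big_nil mul1r.
  have mXB i : measurable (X i @^-1` B i) by rewrite -[X in measurable X]setTI; exact: mX.
  rewrite (_ : (\prod_(i <- F2) fine (P (X i @^-1` B i)))%:E =
               (\prod_(i <- F2) P (X i @^-1` B i))%E); last first.
    elim: F2 {uF} => [|j F2 IH]; first by rewrite !big_nil.
    by rewrite !big_cons EFinM IH fineK// fin_num_measure.
  case: indepX => _ /(_ _ uF _ mB) <-.
  rewrite -[X in P X]setIT -integral_indic//; last first.
    by rewrite bigcap_seq; exact: bigsetI_measurable.
  apply: eq_integral => w _; congr (_%:E).
  elim: F2 {uF} => [|j F2 IH]; first by rewrite big_nil bigcap_seq big_nil indicT.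
  by rewrite big_cons IH !bigcap_seq big_cons indicI.
move=> /andP[iF uF].
pose W w := (\prod_(i <- F1) f i (X i w)) * (\prod_(i <- F2) \1_(B i) (X i w)).
pose c := (\prod_(i <- F1) e i) * (\prod_(i <- F2) fine (P (X i @^-1` B i))).
have c0 : 0 <= c by rewrite mulr_ge0// prodr_ge0// => j _; rewrite fine_ge0.
transitivity (\int[P]_w (f i (X i w) * W w)%:E)%E.
  by apply: eq_integral => w _; rewrite big_cons -mulrA.
rewrite big_cons -mulrA -/c.
pose Xi : {mfun T >-> R} := HB.pack (X i) (isMeasurableFun.Build _ _ _ _ (X i) (mX i)).
rewrite -(ge0_integral_density (nu := mscale (NngNum c0) (pushforward P Xi))) //=.
- have mEf : measurable_fun setT (fun y => (f i y)%:E) by apply/measurable_EFinP; exact: mf.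
  have f0' : {in setT, forall y, 0 <= (f i y)%:E}%E by move=> y _; rewrite lee_fin.
  rewrite ge0_integral_mscale//=; last by move=> y _; rewrite lee_fin.
  rewrite [X in (_ * X)%E](ge0_integral_pushforward (mX i) P measurableT mEf f0').
  by rewrite preimage_setT /comp fe -EFinM mulrC.
- apply: measurable_funM; apply: measurable_prod => j _ //.
  by apply: measurableT_comp => //; exact: measurable_indic.
- by move=> w; rewrite mulr_ge0// prodr_ge0// => j _.
- move=> A mA.
  (* The induction hypothesis is used with [i] moved among the indicators and carrying the set [A].
     By uniqueness of the indices the other sets are unaffected, so the density integrates over [A]
     to [c] times the law of [X i]. *)
  pose B' j := if j == i then A else B j.
  have mB' j : measurable (B' j) by rewrite /B'; case: ifP.
  have B'E j : j \in F2 -> B' j = B j.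
    move=> jF; rewrite /B'; case: eqP => // ji.
    by move: iF; rewrite mem_cat -ji jF orbT.
  have /(_ _) := IH (i :: F2) B' mB'.
  have -> : uniq (F1 ++ i :: F2) by rewrite -cat1s uniq_catCA/= iF.
  move=> /(_ isT) IHB.
  transitivity (\int[P]_w (\prod_(i0 <- F1) f i0 (X i0 w) *
      \prod_(i0 <- (i :: F2)) \1_(B' i0) (X i0 w))%:E)%E; last first.
    apply: eq_integral => w _; rewrite big_cons {1}/B' eqxx mulrCA; congr (_ * (_ * _))%:E.
    by apply: eq_big_seq => j jF; rewrite B'E.
  rewrite IHB big_cons {1}/B' eqxx.
  rewrite /mscale/= /pushforward/= -[P _]fineK ?fin_num_measure//; last first.
    by rewrite -[X in measurable X]setTI; exact: mX.
  rewrite -EFinM; congr (_%:E); rewrite mulrCA mulrC; congr (_ * (_ * _)).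
  by apply: eq_big_seq => j jF; rewrite B'E.
Qed.

Lemma independent_integral_prod_ge0 (f : I -> R -> R) (e : I -> R) (F : seq I) :
  (forall i, measurable_fun setT (f i)) -> (forall i y, 0 <= f i y) ->
  (forall i, \int[P]_w (f i (X i w))%:E = (e i)%:E)%E -> uniq F ->
  (\int[P]_w (\prod_(i <- F) f i (X i w))%:E = (\prod_(i <- F) e i)%:E)%E.
Proof.
move=> mf f0 fe uF.
have := @independent_integral_prod_indic f e F [::] (fun=> setT) mf f0 fe.
rewrite cats0 big_nil mulr1 => <-//.
by apply: eq_integral => w _; rewrite big_nil mulr1.
Qed.

(** The nonnegative product formula, applied to absolute values, gives a finite integral. *)
Lemma independent_integrable_prod (f : I -> R -> R) (F : seq I) :
  (forall i, measurable_fun setT (f i)) ->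
  (forall i, P.-integrable setT (fun w => (f i (X i w))%:E)) -> uniq F ->
  P.-integrable setT (fun w => (\prod_(i <- F) f i (X i w))%:E).
Proof.
move=> mf intf uF; apply/integrableP; split.
  apply/measurable_EFinP; apply: measurable_prod => i _.
  exact: measurableT_comp.
rewrite (_ : (\int[P]_x `|(\prod_(i <- F) f i (X i x))%:E|)%E =
   (\prod_(i <- F) fine (\int[P]_w `|(f i (X i w))%:E|))%:E)%E ?ltry//.
rewrite -(@independent_integral_prod_ge0 (fun i y => `|f i y|))//.
- by apply: eq_integral => w _; rewrite abse_EFin normr_prod.
- by move=> i; apply: measurableT_comp.
- move=> i; rewrite fineK//.
  exact: integrable_fin_num (integrable_abse (intf i)).
Qed.

(** [F2] collects the factors already known to be nonnegative. Induction on [F1] splits its first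
    factor into positive and negative parts, each of which can join [F2], and subtracts the two
    formulas. *)
Lemma independent_integral_prod_cat (f : I -> R -> R) (F1 F2 : seq I) :
  (forall i, measurable_fun setT (f i)) ->
  (forall i, P.-integrable setT (fun w => (f i (X i w))%:E)) ->
  (forall i, i \in F2 -> forall y, 0 <= f i y) -> uniq (F1 ++ F2) ->
  (\int[P]_w (\prod_(i <- F1 ++ F2) f i (X i w))%:E =
   (\prod_(i <- F1 ++ F2) fine (\int[P]_w (f i (X i w))%:E))%:E)%E.
Proof.
elim: F1 F2 f => [|i F1 IH] F2 f mf intf f0 uF.
  rewrite cat0s in uF *.
  (* Zero outside [F2] makes the family nonnegative at every index, as the nonnegative case
     demands. *)
  pose g i := if i \in F2 then f i else fun=> 0.
  transitivity (\int[P]_w (\prod_(i <- F2) g i (X i w))%:E)%E.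
    by apply: eq_integral => w _; congr (_%:E); apply: eq_big_seq => i iF; rewrite /g iF.
  rewrite (@independent_integral_prod_ge0 g (fun i => fine (\int[P]_w (g i (X i w))%:E)))//.
  - congr (_%:E); apply: eq_big_seq => i iF; congr fine.
    by apply: eq_integral => w _; rewrite /g iF.
  - by move=> i; rewrite /g; case: ifP.
  - by move=> i y; rewrite /g; case: ifPn => // /f0.
  - move=> i; rewrite fineK// /g; case: ifPn => _; last by rewrite integral0.
    exact: integrable_fin_num.
move: (uF) => /= /andP[iF uF'].
(* [upd h] puts a nonnegative [h] in place of the factor at [i]; [h] will be the positive, then the
   negative part of [f i]. *)
pose upd (h : R -> R) j := if j == i then h else f j.
have updE h j : j \in F1 ++ F2 -> upd h j = f j.
  by rewrite /upd; case: eqP => // ->; rewrite (negbTE iF).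
have key (h : R -> R) : measurable_fun setT h ->
    (forall y, 0 <= h y) -> (forall y, h y <= `|f i y|) ->
    P.-integrable setT (fun w => (h (X i w))%:E) /\
    P.-integrable setT (fun w => (h (X i w) * \prod_(i <- F1 ++ F2) f i (X i w))%:E) /\
    (\int[P]_w (h (X i w) * \prod_(i <- F1 ++ F2) f i (X i w))%:E =
    (fine (\int[P]_w (h (X i w))%:E) *
      \prod_(i <- F1 ++ F2) fine (\int[P]_w (f i (X i w))%:E))%:E)%E.
  move=> mh h0 hf.
  have inth : P.-integrable setT (fun w => (h (X i w))%:E).
    apply: (le_integrable measurableT _ _ (intf i)).
      by apply/measurable_EFinP; apply: measurableT_comp.
    by move=> w _; rewrite !abse_EFin lee_fin ger0_norm.
  have mupd j : measurable_fun setT (upd h j) by rewrite /upd; case: ifP.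
  have intupd j : P.-integrable setT (fun w => (upd h j (X j w))%:E).
    by rewrite /upd; case: eqP => // ->.
  have uF1 : uniq (F1 ++ i :: F2) by rewrite -cat1s uniq_catCA/= iF.
  have perm : perm_eq (F1 ++ i :: F2) (i :: F1 ++ F2).
    by rewrite -cat1s perm_catCA.
  have bigE w : \prod_(j <- F1 ++ i :: F2) upd h j (X j w) =
      h (X i w) * \prod_(i <- F1 ++ F2) f i (X i w).
    rewrite (perm_big _ perm)/= big_cons {1}/upd eqxx; congr (_ * _).
    by apply: eq_big_seq => j jF; rewrite updE.
  split => //; split.
    under eq_fun do rewrite -bigE.
    exact: independent_integrable_prod.
  under eq_integral do rewrite -bigE.
  rewrite IH//.
    rewrite (perm_big _ perm)/= big_cons {1}/upd eqxx; congr (_ * _)%:E.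
    by apply: eq_big_seq => j jF; rewrite updE.
  move=> j; rewrite inE /upd; case: eqP => //= _ jF; exact: f0.
have [p1 [p2 p3]] := key (fun y => Num.max (f i y) 0)
  (measurable_maxr (mf i) (measurable_cst _)) (fun y => ltac:(by rewrite le_max lexx orbT))
  (fun y => ltac:(by rewrite ge_max normr_ge0 ler_norm)).
have mN : measurable_fun setT (fun y => - f i y) by exact: measurableT_comp.
have [n1 [n2 n3]] := key (fun y => Num.max (- f i y) 0)
  (measurable_maxr mN (measurable_cst _)) (fun y => ltac:(by rewrite le_max lexx orbT))
  (fun y => ltac:(by rewrite ge_max normr_ge0 -normrN ler_norm)).
have fE y : f i y = Num.max (f i y) 0 - Num.max (- f i y) 0.
  by rewrite !maxEle; case: leP => ?; case: leP => ?; lra.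
rewrite /= big_cons.
under eq_integral do rewrite big_cons fE mulrBl EFinB.
rewrite integralB//= p3 n3 -EFinB -mulrBl; congr (_ * _)%:E.
under [in RHS]eq_integral do rewrite fE EFinB.
by rewrite integralB//= (fineB (integrable_fin_num measurableT p1) (integrable_fin_num measurableT n1)).
Qed.

Lemma independent_integral_prod (f : I -> R -> R) (F : seq I) :
  (forall i, measurable_fun setT (f i)) ->
  (forall i, P.-integrable setT (fun w => (f i (X i w))%:E)) -> uniq F ->
  (\int[P]_w (\prod_(i <- F) f i (X i w))%:E =
   (\prod_(i <- F) fine (\int[P]_w (f i (X i w))%:E))%:E)%E.
Proof.
move=> mf intf uF; rewrite -[F]cats0.
by apply: independent_integral_prod_cat => //; rewrite cats0.
Qed.

End independent_products.

(** * Strong law of large numbers for uncorrelated variables *)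

Lemma nat_sqrt_ex (m : nat) : exists n, (n ^ 2 <= m < n.+1 ^ 2)%N.
Proof.
elim: m => [|m [n /andP[n1 n2]]]; first by exists 0%N.
have [h|h] := ltnP m.+1 (n.+1 ^ 2)%N; first by exists n; rewrite h (leq_trans n1).
by exists n.+1; rewrite h /=; lia.
Qed.

(** * Reduction of the means to sums along the squares and over the gaps *)

Section block_energy.
Context {R : realType}.
Implicit Type z : nat -> R.

(* Dominates the square of each partial sum of length m, n^2 <= m < (n+1)^2. *)
Definition block_energy z (n : nat) : R :=
  (\sum_(0 <= i < n ^ 2) z i) ^+ 2 +
  \sum_(k < n.*2.+1) (\sum_(n ^ 2 <= i < n ^ 2 + k) z i) ^+ 2.

Lemma block_energy_ge0 z n : 0 <= block_energy z n.
Proof. by rewrite addr_ge0 ?sqr_ge0 ?sumr_ge0// => i _; rewrite sqr_ge0. Qed.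

(** Cut the sum at n^2 and use (a + b)^2 <= 2 (a^2 + b^2). The remainder has at most 2n terms, so
    its square is one summand of the gap part of the energy. *)
Lemma sum_sqr_le_block_energy z n m : (n ^ 2 <= m < n.+1 ^ 2)%N ->
  (\sum_(0 <= i < m) z i) ^+ 2 <= 2 * block_energy z n.
Proof.
move=> /andP[nm mn].
have km : (m - n ^ 2 < n.*2.+1)%N by lia.
rewrite (@big_cat_nat _ _ _ (n ^ 2)) //= /block_energy.
rewrite (bigD1 (Ordinal km))//= subnKC//.
set a := \sum_(0 <= i < n ^ 2) _; set b := \sum_(n ^ 2 <= i < m) _.
set r := \sum_(_ < _ | _) _.
have : 0 <= r by rewrite sumr_ge0// => i _; rewrite sqr_ge0.
have := sqr_ge0 (a - b); lra.
Qed.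

(** For n^2 <= m < (n+1)^2 the squared mean is at most twice the energy over m^2, and m^2 >= n^4.
    Hence the threshold e^2/2 below. *)
Lemma cvg_mean_block_energy z :
  (fun n => block_energy z n.+1 / n.+1%:R ^+ 4) @ \oo --> (0 : R) ->
  (fun m => (\sum_(0 <= i < m) z i) / m%:R) @ \oo --> (0 : R).
Proof.
move=> /cvgrPdist_lt u0; apply/cvgrPdist_lt => e e0.
have [|N _ HN] := u0 (e ^+ 2 / 2); first by rewrite divr_gt0// exprn_gt0.
near=> m.
have [n /[dup] nmn /andP[nm mn]] := nat_sqrt_ex m.
(* From (N+2)^2 <= m < (n+1)^2. Thus n is a successor whose predecessor is at least [N], matching
   the shifted index of the hypothesis. *)
have Nn : (N < n)%N.
  have : (N.+2 ^ 2 <= m)%N by near: m; exact: nbhs_infty_ge.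
  by move: mn; nia.
case: n => // n in nmn nm mn Nn *.
have := HN n Nn; rewrite /= !sub0r !normrN ger0_norm; last first.
  by rewrite divr_ge0 ?block_energy_ge0.
have n40 : 0 < n.+1%:R ^+ 4 :> R by rewrite exprn_gt0.
rewrite ltr_pdivrMr// => Hu.
have m0 : 0 < m%:R :> R by rewrite ltr0n; lia.
rewrite normrM normfV (gtr0_norm m0) ltr_pdivrMr//.
rewrite -(@ltr_pXn2r _ 2) ?nnegrE ?mulr_ge0 ?(ltW e0)//.
rewrite real_normK ?num_real//.
apply: (le_lt_trans (sum_sqr_le_block_energy z nmn)).
have h : n.+1%:R ^+ 4 <= m%:R ^+ 2 :> R.
  by rewrite -!natrX ler_nat; nia.
have e20 : 0 < e ^+ 2 by rewrite exprn_gt0.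
rewrite exprMn; nra.
Unshelve. all: by end_near. Qed.

End block_energy.

(** * Second-moment estimates and almost sure convergence *)

Section uncorrelated_slln.
Context d (T : measurableType d) (R : realType) (P : probability T R).
Context (Z : nat -> T -> R) (C : R).
Hypothesis mZ : forall m, measurable_fun setT (Z m).
Hypothesis Z2 : forall m, (\int[P]_w (Z m w ^+ 2)%:E <= C%:E)%E.
Hypothesis uncorZ : forall m n, m != n -> (\int[P]_w (Z m w * Z n w)%:E = 0)%E.

Let C0 : 0 <= C.
Proof.
rewrite -lee_fin; apply: le_trans (Z2 0); apply: integral_ge0 => w _.
by rewrite lee_fin sqr_ge0.
Qed.

Let intZ2 m : P.-integrable setT (fun w => (Z m w ^+ 2)%:E).
Proof.
apply/integrableP; split; first exact/measurable_EFinP/measurable_funX.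
apply: le_lt_trans (ltry C); apply: le_trans (Z2 m).
by under eq_integral do rewrite abse_EFin ger0_norm ?sqr_ge0//.
Qed.

Let intZZ m n : P.-integrable setT (fun w => (Z m w * Z n w)%:E).
Proof.
have H := integrableD measurableT (intZ2 m) (intZ2 n).
apply: (le_integrable measurableT _ _ H).
  exact/measurable_EFinP/measurable_funM.
move=> w _; rewrite abse_EFin lee_fin.
rewrite [leRHS]ger0_norm ?addr_ge0 ?sqr_ge0//.
have := sqr_ge0 (Z m w - Z n w); have := sqr_ge0 (Z m w + Z n w).
have := sqr_ge0 (Z m w); have := sqr_ge0 (Z n w).
by rewrite ler_norml => *; apply/andP; split; lra.
Qed.

(** Expanding the square, the cross terms vanish and each of the b - a diagonal terms is at most
    [C]. *)
Let integral_sum_sqr (a b : nat) :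
  (\int[P]_w ((\sum_(a <= i < b) Z i w) ^+ 2)%:E <= (C * (b - a)%:R)%:E)%E.
Proof.
under eq_integral do rewrite expr2 big_distrlr/= -sumEFin.
rewrite integral_sum//; last first.
  move=> i; under eq_fun do rewrite -sumEFin; exact: integrable_sum.
apply: (@le_trans _ _ (\sum_(a <= i < b) C%:E)%E); last first.
  by rewrite sumEFin sumr_const_nat mulr_natr.
rewrite !big_seq; apply: lee_sum => i iab.
under eq_integral do rewrite -sumEFin.
rewrite integral_sum// (bigD1_seq i) ?iota_uniq//= big1_seq ?adde0.
  by under eq_integral do rewrite -expr2.
by move=> j /andP[ji _]; rewrite uncorZ// eq_sym.
Qed.

Let mS a b : measurable_fun setT (fun w => (\sum_(a <= i < b) Z i w) ^+ 2).
Proof. by apply: measurable_funX; exact: measurable_sum. Qed.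

(** The shift to n+1 keeps the denominator nonzero. *)
Let V n w := block_energy (fun i => Z i w) n.+1 / n.+1%:R ^+ 4.

Let mV n : measurable_fun setT (V n).
Proof.
apply: measurable_funM => //; apply: measurable_funD; first exact: mS.
by apply: measurable_sum => k; exact: mS.
Qed.

Let V0 n w : 0 <= V n w.
Proof. by rewrite divr_ge0 ?block_energy_ge0. Qed.

(** With n standing for the successor, the total is at most C (n^2 + 2n(2n+1)): 2n+1 gap sums, each
    of at most 2n terms. The 10 is a generous bound for n >= 1. *)
Let integral_block_energy n :
  (\int[P]_w (block_energy (fun i => Z i w) n.+1)%:E <= (10 * C * n.+1%:R ^+ 2)%:E)%E.
Proof.
rewrite /block_energy; under eq_integral do rewrite EFinD -sumEFin.
rewrite ge0_integralD//; last 4 first.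
- by move=> w _; rewrite lee_fin sqr_ge0.
- exact/measurable_EFinP.
- by move=> w _; apply: sume_ge0 => k _; rewrite lee_fin sqr_ge0.
- by apply: emeasurable_sum => k; exact/measurable_EFinP.
rewrite ge0_integral_sum//; last 2 first.
- by move=> k; exact/measurable_EFinP.
- by move=> k w _; rewrite lee_fin sqr_ge0.
apply: (@le_trans _ _ ((C * (n.+1 ^ 2)%:R)%:E +
    \sum_(k < n.+1.*2.+1) (C * (n.+1.*2)%:R)%:E)%E).
  apply: leeD; first by have := integral_sum_sqr 0 (n.+1 ^ 2); rewrite subn0.
  apply: lee_sum => k _; apply: le_trans (integral_sum_sqr _ _) _.
  by rewrite addKn lee_fin ler_wpM2l// ler_nat -ltnS.
rewrite sumEFin sumr_const card_ord -EFinD lee_fin -[X in _ + X]mulr_natr.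
have -> : C * (n.+1 ^ 2)%:R + C * (n.+1.*2)%:R * (n.+1.*2.+1)%:R =
    C * (n.+1 ^ 2 + n.+1.*2 * n.+1.*2.+1)%:R by rewrite natrD natrM; ring.
have -> : 10 * C * n.+1%:R ^+ 2 = C * (10 * n.+1 ^ 2)%:R.
  by rewrite natrM natrX; ring.
by rewrite ler_wpM2l// ler_nat; nia.
Qed.

(** The energy bound over n^4 is of order 1/n^2, put in telescoping form through 1/n^2 <= 2 (1/n -
    1/(n+1)). *)
Let integral_V n : (\int[P]_w (V n w)%:E <= (20 * C * (n.+1%:R^-1 - n.+2%:R^-1))%:E)%E.
Proof.
under eq_integral do rewrite /V mulrC EFinM.
have n0 : 0 < n.+1%:R :> R by [].
rewrite ge0_integralZl//; last 2 first.
- apply/measurable_EFinP; apply: measurable_funD; first exact: mS.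
  by apply: measurable_sum => k; exact: mS.
- by move=> w _; rewrite lee_fin block_energy_ge0.
apply: le_trans (lee_wpmul2l _ (integral_block_energy n)) _.
  by rewrite lee_fin invr_ge0 exprn_ge0.
rewrite -EFinM lee_fin.
have -> : n.+2%:R = n.+1%:R + 1 :> R by rewrite natr1.
have : 1 <= n.+1%:R :> R by rewrite ler1n.
move: (n.+1%:R : R) n0 => x x0 x1.
have -> : (x ^+ 4)^-1 * (10 * C * x ^+ 2) = (10 * C) * (x ^+ 2)^-1.
  by field; rewrite gt_eqF.
have -> : 20 * C * (x^-1 - (x + 1)^-1) = (10 * C) * (2 * (x^-1 - (x + 1)^-1)) by ring.
have y0 : 0 < x + 1 by lra.
have -> : 2 * (x^-1 - (x + 1)^-1) = 2 / (x * (x + 1)).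
  by field; rewrite !gt_eqF.
rewrite ler_wpM2l ?mulr_ge0//.
rewrite ler_pdivlMr ?mulr_gt0// mulrC ler_pdivrMr ?exprn_gt0//; nra.
Qed.

(** The series of the [V n] has expectation at most 20 C by telescoping, so it is finite almost
    surely; its terms then tend to 0, which is the criterion [cvg_mean_block_energy]. *)
Lemma uncorrelated_slln :
  {ae P, forall w, (fun n => (\sum_(0 <= i < n) Z i w) / n%:R) @ \oo --> (0 : R)}.
Proof.
pose W w := (\sum_(0 <= n <oo) (V n w)%:E)%E.
have W0 w : (0 <= W w)%E by apply: nneseries_ge0 => n _ _; rewrite lee_fin.
have intW : P.-integrable setT W.
  apply/integrableP; split.
    apply: (ge0_emeasurable_sum (h := fun n w => (V n w)%:E) (P := xpredT)).
      by move=> n w _ _; rewrite lee_fin.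
    by move=> n _; apply/measurable_EFinP; exact: mV.
  under eq_integral do rewrite gee0_abs//.
  rewrite integral_nneseries//; last 2 first.
    by move=> n; apply/measurable_EFinP; exact: mV.
    by move=> n w _; rewrite lee_fin.
  apply: le_lt_trans (ltry (20 * C)).
  apply: lime_le.
    by apply: is_cvg_nneseries => n _ _; apply: integral_ge0 => w _; rewrite lee_fin.
  near=> n.
  apply: (@le_trans _ _ (\sum_(0 <= k < n) (20 * C * (k.+1%:R^-1 - k.+2%:R^-1))%:E)%E).
    by apply: lee_sum => k _; exact: integral_V.
  rewrite sumEFin lee_fin -mulr_sumr.
  have -> : \sum_(0 <= k < n) (k.+1%:R^-1 - k.+2%:R^-1) = 1 - n.+1%:R^-1 :> R.
    under eq_bigr do rewrite -opprB.
    by rewrite sumrN (telescope_sumr (fun k => k.+1%:R^-1)) // opprB invr1.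
  by rewrite ler_piMr ?mulr_ge0// gerBl invr_ge0.
have := integrable_ae measurableT intW.
apply: filterS => w /(_ Logic.I) Wfin.
apply: cvg_mean_block_energy; rewrite -/(V _ w).
apply: cvg_series_cvg_0; apply: nondecreasing_is_cvgn.
  by apply: nondecreasing_series => n _ _; exact: V0.
exists (fine (W w)) => _ [n _ <-].
rewrite -lee_fin fineK// /series/= -sumEFin.
by apply: (@nneseries_lim_ge _ (fun n => (V n w)%:E) xpredT 0 n) => k _ _; rewrite lee_fin; exact: V0.
Unshelve. all: by end_near. Qed.

End uncorrelated_slln.

(** * Strong laws for products and squares of the Gaussian variables *)

Section gaussian_slln.
Context d (T : measurableType d) (R : realType) (P : probability T R).
Context (I : choiceType) (X : I -> T -> R).
Hypothesis indepX : mutually_independent P X.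
Hypothesis lawX : forall k, has_law_normal_half P (X k).
Local Notation pdf := (normal_pdf 0 (Num.sqrt (2^-1 : R))).

Let mX k : measurable_fun setT (X k). Proof. by case: indepX. Qed.

(** Two different products involve four distinct variables, so their correlation factors into means,
    the first of which is 0. The second moment of each product is the squared variance. *)
Lemma slln_product (p q : nat -> I) :
  (forall m, p m != q m) -> (forall m n, m != n -> uniq [:: p m; q m; p n; q n]) ->
  {ae P, forall w, (fun n => (\sum_(0 <= m < n) X (p m) w * X (q m) w) / n%:R) @ \oo --> (0 : R)}.
Proof.
move=> pq pqu.
pose v := fine (\int[lebesgue_measure]_x (x ^+ 2 * pdf x)%:E)%E.
apply: (@uncorrelated_slln _ _ _ _ _ (v * v)).
- by move=> m; apply: measurable_funM.
- move=> m.
  have msq : measurable_fun setT (fun y : R => y ^+ 2) by exact: exprn_measurable.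
  have := @independent_integral_prod _ _ _ _ _ _ indepX (fun _ y => y ^+ 2) [:: p m; q m] (fun=> msq).
  rewrite /= inE pq.
  under eq_integral do rewrite !big_cons big_nil mulr1 -exprMn.
  rewrite !big_cons big_nil mulr1 => -> //.
    by rewrite !(integral_normal_half (mX _) (@lawX _) msq).
  by move=> k; apply: (integrable_comp_normal_half (mX k) (@lawX k) msq); exact: sqr_le_1Dx4.
- move=> m n mn.
  have mid : measurable_fun setT (fun y : R => y) by exact: measurable_id.
  have := @independent_integral_prod _ _ _ _ _ _ indepX (fun _ y => y)
    [:: p m; q m; p n; q n] (fun=> mid) _ (pqu _ _ mn).
  under eq_integral do rewrite !big_cons big_nil mulr1 mulrA.
  rewrite big_cons (integral_normal_half (mX _) (@lawX _) mid) normal_half_mean mul0r => -> //.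
  by move=> k; apply: (integrable_comp_normal_half (mX k) (@lawX k) mid); exact: norm_le_1Dx4.
Qed.

(** The centered squares X^2 - 1/2 are uncorrelated, by independence and the value 1/2 of the
    variance, and share one second moment [v]. *)
Lemma slln_square (p : nat -> I) : injective p ->
  {ae P, forall w, (fun n => (\sum_(0 <= m < n) X (p m) w * X (p m) w) / n%:R) @ \oo --> (2^-1 : R)}.
Proof.
move=> pinj.
have mh : measurable_fun setT (fun y : R => y ^+ 2 - 2^-1).
  by apply: measurable_funB => //; exact: exprn_measurable.
have mh2 : measurable_fun setT (fun y : R => (y ^+ 2 - 2^-1) ^+ 2) by exact: measurable_funX.
pose v := fine (\int[lebesgue_measure]_x ((x ^+ 2 - 2^-1) ^+ 2 * pdf x)%:E)%E.
have Hm m : measurable_fun setT (fun w => X (p m) w ^+ 2 - 2^-1).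
  exact: (measurableT_comp mh (mX (p m))).
have H2 m : (\int[P]_w ((X (p m) w ^+ 2 - 2^-1) ^+ 2)%:E <= v%:E)%E.
  have int2 := integrable_comp_normal_half (mX (p m)) (@lawX (p m)) mh2 (@centered_sqr_sqr_le_1Dx4 R).
  rewrite /v -(integral_normal_half (mX (p m)) (@lawX (p m)) mh2) fineK//.
  exact: (integrable_fin_num measurableT int2).
have Hu m n : m != n -> (\int[P]_w ((X (p m) w ^+ 2 - 2^-1) * (X (p n) w ^+ 2 - 2^-1))%:E = 0)%E.
  move=> mn.
  have := @independent_integral_prod _ _ _ _ _ _ indepX (fun _ y => y ^+ 2 - 2^-1) [:: p m; p n] (fun=> mh).
  rewrite /= inE (inj_eq pinj) mn.
  under eq_integral do rewrite !big_cons big_nil mulr1.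
  rewrite big_cons (integral_normal_half (mX _) (@lawX _) mh) normal_half_variance mul0r => -> //.
  by move=> k; apply: (integrable_comp_normal_half (mX k) (@lawX k) mh); exact: centered_sqr_le_1Dx4.
have := uncorrelated_slln Hm H2 Hu; apply: filterS => w cw.
have cw' : (fun n => (\sum_(0 <= i < n) (X (p i) w ^+ 2 - 2^-1)) / n%:R + 2^-1) @ \oo --> (2^-1 : R).
  by rewrite -[X in _ --> X]add0r; apply: cvgD; [exact: cw|exact: cvg_cst].
refine (cvg_trans (near_eq_cvg _) cw'); near=> n.
(* Restoring the mean 1/2 needs (n/2)/n = 1/2, which fails at n = 0; hence only an eventual
   equality. *)
have n0 : n%:R != 0 :> R by rewrite gt_eqF//; near: n; exact: nbhs_infty_gtr.
rewrite /= sumrB sumr_const_nat subn0 mulrBl -[2^-1 *+ n]mulr_natr mulfK// subrK.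
by congr (_ / _); apply: eq_bigr => m _; rewrite expr2.
Unshelve. all: by end_near. Qed.

End gaussian_slln.

(** * Convergence of matrix inverses *)

(** With A = HKB + s and W = BHK + s one has WB = BA; it remains to multiply by both inverses. *)
Lemma push_through (F : fieldType) m n (H : 'M[F]_(m, n)) (K : 'M[F]_n) (B : 'M[F]_(n, m)) (s : F) :
  s != 0 -> B *m H *m K + s%:M \in unitmx ->
  B *m invmx (H *m K *m B + s%:M) = invmx (B *m H *m K + s%:M) *m B.
Proof.
move=> s0 uW; set W := _ + s%:M in uW *; set A := _ + s%:M.
have AHK : A *m (H *m K) = H *m K *m W.
  by rewrite /A /W mulmxDl mulmxDr scalar_mxC !mulmxA.
have WB : W *m B = B *m A.
  by rewrite /A /W mulmxDl mulmxDr scalar_mxC !mulmxA.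
have uA : A \in unitmx.
  (* Invertibility of A comes from that of W through the Woodbury formula for its inverse. *)
  suff : A *m (s^-1 *: (1%:M - H *m K *m (invmx W *m B))) = 1%:M by case/mulmx1_unit.
  rewrite -scalemxAr mulmxBr mulmx1 [A *m (H *m K *m _)]mulmxA AHK -[_ *m W *m _]mulmxA.
  by rewrite mulKVmx// {1}/A addrAC subrr add0r scale_scalar_mx mulVf.
by rewrite -[LHS](mulKmx uW) [W *m _]mulmxA WB mulmxK.
Qed.

Section entrywise_convergence.
Context {K : numFieldType}.

Lemma cvg_bigsum (I : Type) (r : seq I) (Q : pred I) (u : I -> nat -> K) (l : I -> K) :
  (forall i, Q i -> u i @ \oo --> l i) ->
  (fun n => \sum_(i <- r | Q i) u i n) @ \oo --> \sum_(i <- r | Q i) l i.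
Proof.
move=> ul; elim: r => [|i r IH].
  by under eq_fun do rewrite big_nil; rewrite big_nil; exact: cvg_cst.
under eq_fun do rewrite big_cons; rewrite big_cons; case: ifP => // Qi.
by apply: cvgD => //; exact: ul.
Qed.

Lemma cvg_bigprod (I : Type) (r : seq I) (u : I -> nat -> K) (l : I -> K) :
  (forall i, u i @ \oo --> l i) ->
  (fun n => \prod_(i <- r) u i n) @ \oo --> \prod_(i <- r) l i.
Proof.
move=> ul; elim: r => [|i r IH].
  by under eq_fun do rewrite big_nil; rewrite big_nil; exact: cvg_cst.
by under eq_fun do rewrite big_cons; rewrite big_cons; apply: cvgM.
Qed.

(** Entrywise limits suit determinants and adjugates, which are polynomials in the entries. *)
Definition cvg_entries m n (A : nat -> 'M[K]_(m, n)) (B : 'M[K]_(m, n)) :=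
  forall i j, (fun k => A k i j) @ \oo --> B i j.

Lemma cvg_entries_mul m n p (A : nat -> 'M[K]_(m, n)) (B : nat -> 'M[K]_(n, p)) A0 B0 :
  cvg_entries A A0 -> cvg_entries B B0 -> cvg_entries (fun k => A k *m B k) (A0 *m B0).
Proof.
move=> cA cB i j; rewrite mxE; under eq_fun do rewrite mxE.
by apply: cvg_bigsum => l _; apply: cvgM.
Qed.

Lemma cvg_entries_cst m n (A : 'M[K]_(m, n)) : cvg_entries (fun=> A) A.
Proof. by move=> i j; exact: cvg_cst. Qed.

Lemma cvg_entries_add m n (A B : nat -> 'M[K]_(m, n)) A0 B0 :
  cvg_entries A A0 -> cvg_entries B B0 -> cvg_entries (fun k => A k + B k) (A0 + B0).
Proof.
by move=> cA cB i j; rewrite mxE; under eq_fun do rewrite mxE; apply: cvgD.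
Qed.

Lemma cvg_det n (A : nat -> 'M[K]_n) A0 :
  cvg_entries A A0 -> (fun k => \det (A k)) @ \oo --> \det A0.
Proof.
move=> cA; apply: cvg_bigsum => s _; apply: cvgM; first exact: cvg_cst.
by apply: cvg_bigprod => i; exact: cA.
Qed.

Lemma cvg_entries_adj n (A : nat -> 'M[K]_n) A0 :
  cvg_entries A A0 -> cvg_entries (fun k => \adj (A k)) (\adj A0).
Proof.
move=> cA i j; rewrite mxE; under eq_fun do rewrite mxE.
apply: cvgM; first exact: cvg_cst.
by apply: cvg_det => k l; rewrite !mxE; under eq_fun do rewrite !mxE; exact: cA.
Qed.

Lemma near_unitmx n (A : nat -> 'M[K]_n) A0 :
  cvg_entries A A0 -> A0 \in unitmx -> \forall k \near \oo, A k \in unitmx.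
Proof.
move=> cA uA; have d0 : `|\det A0| > 0 by rewrite normr_gt0 -unitfE -unitmxE.
have /cvgrPdist_lt/(_ _ d0) := cvg_det cA.
apply: filterS => k; rewrite unitmxE unitfE; apply: contraTneq => ->.
by rewrite subr0 ltxx.
Qed.

(** Through the formula (det A)^-1 adj A, whose two factors converge. *)
Lemma cvg_entries_invmx n (A : nat -> 'M[K]_n) A0 :
  cvg_entries A A0 -> A0 \in unitmx -> cvg_entries (fun k => invmx (A k)) (invmx A0).
Proof.
move=> cA uA i j.
have lim : (fun k => (\det (A k))^-1 * \adj (A k) i j) @ \oo --> (\det A0)^-1 * \adj A0 i j.
  apply: cvgM; last exact: cvg_entries_adj.
  by apply: cvgV; [rewrite -unitfE -unitmxE|exact: cvg_det].
rewrite [X in _ --> X](_ : _ = (\det A0)^-1 * \adj A0 i j); last by rewrite /invmx uA [LHS]mxE.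
(* [invmx] returns its argument on a singular matrix, so the adjugate formula holds only once [A k]
   is invertible. *)
refine (cvg_trans (near_eq_cvg _) lim).
by have := near_unitmx cA uA; apply: filterS => k uk; rewrite /invmx uk [RHS]mxE.
Qed.

End entrywise_convergence.

(** * The detector statistic *)

Section complex_modulus.
Context {R : rcfType}.
Implicit Types z w : R[i].

Lemma normr_cabs z : `|z| = (cabs z)%:C%C.
Proof. by rewrite /cabs normc_def. Qed.

Lemma cabs_ge0 z : 0 <= cabs z.
Proof. by rewrite /cabs normc_def /= sqrtr_ge0. Qed.

Lemma cabsM z w : cabs (z * w) = cabs z * cabs w.
Proof. by rewrite /cabs normrM !normr_cabs -rmorphM. Qed.

Lemma cabs_sum (I : Type) (r : seq I) (F : I -> R[i]) :
  cabs (\sum_(i <- r) F i) <= \sum_(i <- r) cabs (F i).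
Proof.
have : `|\sum_(i <- r) F i| <= \sum_(i <- r) `|F i| by exact: ler_norm_sum.
rewrite normr_cabs; under [X in _ <= X]eq_bigr do rewrite normr_cabs.
by rewrite -rmorph_sum lecR.
Qed.

Lemma mulconj_cabs z : z * conjc z = (cabs z ^+ 2)%:C%C.
Proof.
rewrite rmorphXn/= -normr_cabs -add_Re2_Im2.
by case: z => x y; rewrite /GRing.mul/=; congr Complex; ring.
Qed.

Lemma cabs_conj z : cabs (conjc z) = cabs z.
Proof. by rewrite /cabs !normc_def; case: z => x y /=; rewrite sqrrN. Qed.

Lemma cabs_distC z w : cabs (z - w) = cabs (w - z).
Proof. by rewrite /cabs distrC. Qed.

Lemma cabs_real (x : R) : 0 <= x -> cabs x%:C%C = x.
Proof. by move=> x0; rewrite /cabs normc_def /= expr0n addr0 sqrtr_sqr ger0_norm. Qed.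

End complex_modulus.

(** * Limits in the complex field and their real counterparts *)

Section complex_limits.
Context {R : realType}.
Let K : numFieldType := complex R.

Lemma cvg_complex (x y : nat -> R) (x0 y0 : R) :
  x @ \oo --> x0 -> y @ \oo --> y0 ->
  (fun n => Complex (x n) (y n) : K) @ \oo --> (Complex x0 y0 : K).
Proof.
move=> /cvgrPdist_lt cx /cvgrPdist_lt cy; apply/cvgrPdist_lt => -[e e'].
(* The radius is itself a complex number; its positivity forces a zero imaginary part. *)
rewrite ltcE/= => /andP[/eqP e'0 e0].
have e20 : 0 < e / 2 by rewrite divr_gt0.
near=> n.
have hx : `|x0 - x n| < e / 2 by near: n; exact: cx.
have hy : `|y0 - y n| < e / 2 by near: n; exact: cy.
rewrite normc_def e'0 ltcR/=.
rewrite -(ger0_norm (ltW e0)) -sqrtr_sqr ltr_sqrt ?exprn_gt0//.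
by move: hx hy; rewrite !ltr_norml => /andP[? ?] /andP[? ?]; nra.
Unshelve. all: by end_near. Qed.

Lemma cvg_cabs (u : nat -> R[i]) (l : R[i]) : (u : nat -> K) @ \oo --> (l : K) ->
  (fun n => cabs (u n - l)) @ \oo --> (0 : R).
Proof.
move=> /cvgrPdist_lt cu; apply/cvgrPdist_lt => e e0.
have eC0 : 0 < (e%:C)%C :> K by rewrite ltcR.
apply: filterS (cu _ eC0) => n.
by move=> h; rewrite sub0r normrN ger0_norm ?cabs_ge0// cabs_distC -ltcR -normr_cabs.
Qed.

End complex_limits.

(** * Deterministic convergence of the statistic *)

Section detector_statistic.
Context {R : realType} {N : nat}.
Implicit Types (v c : 'I_N -> R).

Let cdiag v : 'M[R[i]]_N := diag_mx (\row_k (v k)%:C%C).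

Lemma ctrmx_diag (r : 'rV[R[i]]_N) : ctrmx (diag_mx r) = diag_mx (map_mx (@conjc R) r).
Proof.
apply/matrixP => i j; rewrite !mxE eq_sym; have [->|_] := eqVneq i j.
  by rewrite mulr1n.
by rewrite !mulr0n conjc0.
Qed.

(** The push-through identity with K = D V D^H and B = H^H. The scale of the gains puts a factor 1/M
    in K, which passes to H^H H and forms the Gram matrix [G]. *)
Lemma gH_regularized (M : nat) (v c : 'I_N -> R) (s : R)
    (H : 'M[R[i]]_(M.+1, N)) (a : 'cV[R[i]]_N) :
  let G := (M.+1%:R^-1)%:C%C *: (ctrmx H *m H) in
  let W := G *m cdiag (fun k => v k * c k) + (s%:C%C)%:M in
  s != 0 -> (forall i, cabs (a i 0) ^+ 2 = c i / M.+1%:R) -> W \in unitmx ->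
  gH v s H a = \sum_i \sum_j
    (M.+1%:R%:C%C * conjc (a i 0) * a j 0) * (invmx W *m G) i j.
Proof.
move=> G W s0 ha uW.
have sC0 : (s%:C)%C != 0 :> R[i] by rewrite (inj_eq (@complexI R)).
have M0 : (M.+1%:R : R) != 0 by [].
set B := ctrmx H.
set Kd := diag_mx a^T *m cdiag v *m ctrmx (diag_mx a^T).
(* In D V D^H each gain meets its conjugate, so only the prescribed squared moduli remain. *)
have KdE : Kd = (M.+1%:R^-1)%:C%C *: cdiag (fun k => v k * c k).
  rewrite /Kd ctrmx_diag !mulmx_diag; apply/matrixP => i j; rewrite !mxE.
  have [->|_] := eqVneq i j; last by rewrite !mulr0n mulr0.
  rewrite !mulr1n mulrAC mulconj_cabs ha -!rmorphM; congr (_%:C)%C.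
  by rewrite mulrC mulrA mulrC.
have WE : W = B *m H *m Kd + (s%:C%C)%:M.
  by rewrite /W /G KdE -scalemxAl -scalemxAr.
have GE : B *m H = M.+1%:R%:C%C *: G.
  by rewrite /G scalerA -rmorphM divff// rmorph1 scale1r.
have gE : gH v s H a =
    (ctrmx a *m (B *m invmx (H *m Kd *m B + (s%:C%C)%:M)) *m H *m a) 0 0.
  by rewrite /gH /Kd /cdiag !mulmxA.
have uW' : B *m H *m Kd + (s%:C%C)%:M \in unitmx by rewrite -WE.
rewrite gE (push_through sC0 uW') -WE.
have -> : ctrmx a *m (invmx W *m B) *m H *m a =
    M.+1%:R%:C%C *: (ctrmx a *m (invmx W *m G) *m a).
  rewrite -[_ *m H]mulmxA -[_ *m B *m H]mulmxA GE.
  by rewrite -!(scalemxAl, scalemxAr).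
set F := invmx W *m G.
rewrite !mxE; under eq_bigr do rewrite mxE mulr_suml.
rewrite exchange_big mulr_sumr; apply: eq_bigr => i _.
rewrite mulr_sumr; apply: eq_bigr => j _; rewrite !mxE /=.
ring.
Qed.

Lemma mul_Complex (x y z w : R) :
  Complex x y * Complex z w = Complex (x * z - y * w) (x * w + y * z).
Proof. by []. Qed.

Lemma real_ComplexE (x : R) : (x%:C)%C = Complex x 0.
Proof. by []. Qed.

Lemma sum_Complex (I : Type) (r : seq I) (x y : I -> R) :
  \sum_(i <- r) Complex (x i) (y i) = Complex (\sum_(i <- r) x i) (\sum_(i <- r) y i).
Proof.
elim: r => [|i r IH]; first by rewrite !big_nil.
by rewrite !big_cons IH.
Qed.

Lemma gram_entry (M : nat) (dist : 'I_N -> R) (alpha : R) (hr hi : nat -> 'I_N -> R) i j :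
  let e k := (Num.sqrt (dist k `^ alpha))^-1 in
  let H := chanH M.+1 dist alpha hr hi in
  let avg x := (\sum_(0 <= m < M.+1) x m) / M.+1%:R in
  ((M.+1%:R^-1)%:C%C *: (ctrmx H *m H)) i j =
  Complex (e i * e j * (avg (fun m => hr m i * hr m j) + avg (fun m => hi m i * hi m j)))
          (e i * e j * (avg (fun m => hr m i * hi m j) - avg (fun m => hi m i * hr m j))).
Proof.
move=> e H avg; rewrite mxE mxE.
rewrite (eq_bigr (fun m : 'I_M.+1 => Complex
    (e i * e j * (hr m i * hr m j + hi m i * hi m j))
    (e i * e j * (hr m i * hi m j - hi m i * hr m j)))); last first.
  move=> m _; rewrite !mxE -/(e i) -/(e j) !(real_ComplexE, mul_Complex).
  by congr Complex; ring.
rewrite sum_Complex /avg !big_mkord -!mulr_sumr big_split sumrB /=.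
by rewrite real_ComplexE mul_Complex; congr Complex; ring.
Qed.

(** The phases of the gains may vary freely with M, so the coefficients M conj(a_i) a_j need not
    converge. Their moduli are constant, equal to sqrt(c_i c_j), and this suffices because the
    matrix they multiply converges. *)
Lemma gH_cvg (v c dist : 'I_N -> R) (s alpha : R) (hr hi : nat -> 'I_N -> R)
    (a : nat -> 'cV[R[i]]_N) :
  let mean x := fun n : nat => (\sum_(0 <= m < n) x m) / n%:R in
  let L := \sum_(i < N) c i / (s * dist i `^ alpha + v i * c i) in
  0 < s -> (forall i, 0 < v i) -> (forall i, 0 < dist i) -> (forall i, 0 <= c i) ->
  (forall i j, mean (fun m => hr m i * hr m j) @ \oo --> ((i == j)%:R / 2 : R)) ->
  (forall i j, mean (fun m => hi m i * hi m j) @ \oo --> ((i == j)%:R / 2 : R)) ->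
  (forall i j, mean (fun m => hr m i * hi m j) @ \oo --> (0 : R)) ->
  (forall M i, cabs (a M i 0) ^+ 2 = c i / M.+1%:R) ->
  (fun M => cabs (gH v s (chanH M.+1 dist alpha hr hi) (a M) - L%:C%C)) @ \oo --> (0 : R).
Proof.
move=> mean L s0 v0 d0 c0 hrr hii hri ha.
pose e k := (Num.sqrt (dist k `^ alpha))^-1.
pose dl k := e k ^+ 2.
have dlE k : dl k = (dist k `^ alpha)^-1.
  by rewrite /dl /e exprVn sqr_sqrtr// ltW// powR_gt0.
have dl0 k : 0 < dl k by rewrite dlE invr_gt0 powR_gt0.
pose den k := dl k * (v k * c k) + s.
have den0 k : 0 < den k.
  by rewrite ltr_wpDl// mulr_ge0 ?(ltW (dl0 k))// mulr_ge0 ?(ltW (v0 k)).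
pose H M := chanH M.+1 dist alpha hr hi.
pose G M := (M.+1%:R^-1)%:C%C *: (ctrmx (H M) *m H M).
pose W M := G M *m cdiag (fun k => v k * c k) + (s%:C%C)%:M.
pose W0 := cdiag dl *m cdiag (fun k => v k * c k) + (s%:C%C)%:M.
have W0E : W0 = cdiag den.
  rewrite /W0 mulmx_diag; apply/matrixP => i j; rewrite !mxE.
  have [->|_] := eqVneq i j; last by rewrite !mulr0n addr0.
  by rewrite !mulr1n -rmorphM -rmorphD.
(* The diagonal of the limit of (G C + s I)^-1 G. *)
pose lam k := dl k / den k.
have W0L : W0 *m cdiag lam = cdiag dl.
  rewrite W0E mulmx_diag; congr diag_mx; apply/rowP => k; rewrite !mxE -rmorphM.
  by rewrite /lam mulrC divfK// gt_eqF.
have uW0 : W0 \in unitmx.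
  rewrite W0E unitmxE det_diag unitfE; apply/prodf_neq0 => k _.
  by rewrite mxE (inj_eq (@complexI R)) gt_eqF.
have L0 : invmx W0 *m cdiag dl = cdiag lam by rewrite -W0L mulKmx.
pose K : numFieldType := complex R.
have cG : @cvg_entries K _ _ G (cdiag dl).
  move=> i j; under eq_fun do rewrite gram_entry.
  (* The limit in the shape of [gram_entry]: real and imaginary parts of the channel each contribute
     1/2 on the diagonal. *)
  have -> : cdiag dl i j = Complex (e i * e j * ((i == j)%:R / 2 + (i == j)%:R / 2)) (e i * e j * (0 - 0)).
    rewrite !mxE; have [->|_] := eqVneq i j.
      by rewrite /= !mulr1n subr0 mulr0 /dl expr2; congr Complex; field.
    by rewrite /= !mulr0n !mul0r addr0 subr0 !mulr0.
  apply: cvg_complex; apply: cvgMr.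
    by apply: cvgD; [have := hrr i j|have := hii i j]; rewrite -cvg_shiftS.
  apply: cvgB; first by have := hri i j; rewrite -cvg_shiftS.
  have := hri j i; rewrite -cvg_shiftS /mean.
  by under eq_fun do under eq_bigr do rewrite mulrC.
have cW : @cvg_entries K _ _ W W0.
  have cC : @cvg_entries K _ _ (fun=> cdiag (fun k => v k * c k)) (cdiag (fun k => v k * c k)).
    exact: cvg_entries_cst.
  exact: (cvg_entries_add (cvg_entries_mul cG cC) (@cvg_entries_cst K _ _ ((s%:C%C)%:M))).
have cF : @cvg_entries K _ _ (fun M => invmx (W M) *m G M) (cdiag lam).
  rewrite -L0; exact: (cvg_entries_mul (cvg_entries_invmx cW uW0) cG).
have nW := near_unitmx cW uW0.
have acabs M i : cabs (a M i 0) = Num.sqrt (c i) / Num.sqrt M.+1%:R.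
  rewrite -(ger0_norm (cabs_ge0 (a M i 0))) -sqrtr_sqr ha.
  by rewrite sqrtrM// sqrtrV.
(* [L] is written with the same coefficients, for every M, so that the difference involves only the
   matrix error; off-diagonal terms are 0. *)
have LE M : L%:C%C = \sum_i \sum_j
    (M.+1%:R%:C%C * conjc (a M i 0) * a M j 0) * cdiag lam i j.
  rewrite /L rmorph_sum; apply: eq_bigr => i _.
  rewrite (bigD1 i)//= big1 ?addr0; last first.
    by move=> j ji; rewrite !mxE eq_sym (negbTE ji) mulr0n mulr0.
  rewrite !mxE eqxx mulr1n -[_ * conjc _ * _]mulrA [conjc _ * _]mulrC mulconj_cabs ha -!rmorphM.
  congr (_%:C)%C; rewrite /lam /den dlE.
  have p0 : dist i `^ alpha != 0 by rewrite gt_eqF// powR_gt0.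
  have q0 : s * dist i `^ alpha + v i * c i != 0.
    by rewrite gt_eqF// ltr_wpDr ?mulr_gt0 ?powR_gt0// mulr_ge0// ltW.
  by field; rewrite p0 addrC q0 /= addrC natr1 pnatr_eq0.
have lim : (fun M => \sum_i \sum_j (Num.sqrt (c i) * Num.sqrt (c j) *
    cabs ((invmx (W M) *m G M) i j - cdiag lam i j))) @ \oo --> (0 : R).
  rewrite [X in _ --> X](_ : _ = \sum_(i < N) \sum_(j < N) (Num.sqrt (c i) * Num.sqrt (c j) * 0)).
    apply: cvg_bigsum => i _; apply: cvg_bigsum => j _.
    by apply: cvgMr; apply: cvg_cabs; exact: cF.
  by rewrite big1// => i _; rewrite big1// => j _; rewrite mulr0.
apply: (squeeze_cvgr _ (cvg_cst 0) lim).
near=> M; rewrite cabs_ge0/=.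
have uW : W M \in unitmx by near: M; exact: nW.
rewrite (gH_regularized (lt0r_neq0 s0) (ha M) uW).
rewrite (LE M) -sumrB; apply: le_trans (cabs_sum _ _) _.
apply: ler_sum => i _; rewrite -sumrB; apply: le_trans (cabs_sum _ _) _.
apply: ler_sum => j _; rewrite -mulrBr cabsM ler_wpM2r ?cabs_ge0//.
rewrite !cabsM cabs_conj !acabs cabs_real//.
have q0 : Num.sqrt M.+1%:R != 0 :> R by rewrite gt_eqF// sqrtr_gt0.
rewrite -[X in X * _ * _](@sqr_sqrtr _ M.+1%:R)// le_eqVlt; apply/orP; left; apply/eqP.
by field.
Unshelve. all: by end_near. Qed.

End detector_statistic.

(** * Almost sure limits of the statistic and of the detection probability *)

Theorem theorem1 (R : realType) (d : measure_display) (T : measurableType d)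
  (P : probability T R) (N : nat)
  (sigth2 sign2 alpha : R) (sigv2 dist c : 'I_N -> R)
  (hr hi : nat -> 'I_N -> T -> R)
  (X := fun (k : nat * 'I_N * bool) =>
          if k.2 then hr k.1.1 k.1.2 else hi k.1.1 k.1.2) :
  0 < sigth2 -> 0 < sign2 -> 0 < alpha ->
  (forall i, 0 < sigv2 i) -> (forall i, 0 < dist i) -> (forall i, 0 <= c i) ->
  mutually_independent P X ->
  (forall k, has_law_normal_half P (X k)) ->
  forall a : forall M : nat, 'cV[R[i]]_N,
  (forall (M : nat) (i : 'I_N), cabs (a M i 0) ^+ 2 = c i / M.+1%:R) ->
  let g := fun (M : nat) (w : T) =>
    gH sigv2 sign2 (chanH M.+1 dist alpha (fun m k => hr m k w) (fun m k => hi m k w))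
       (a M) in
  let L := \sum_(i < N) c i / (sign2 * dist i `^ alpha + sigv2 i * c i) in
  {ae P, forall w,
    (fun M : nat => cabs (g M w - L%:C)%C) @ \oo --> 0%R} /\
  forall eps : R, 0 < eps <= 1 ->
  {ae P, forall w,
    (fun M : nat => eps `^ (1 + sigth2 * complex.Re (g M w))^-1) @ \oo -->
      eps `^ (1 + sigth2 * L)^-1}.
Proof.
move=> th0 s0 _ v0 d0 c0 indepX lawX a ha g L.
have slln (k l : 'I_N * bool) : {ae P, forall w,
    (fun n => (\sum_(0 <= m < n) X (m, k.1, k.2) w * X (m, l.1, l.2) w) / n%:R) @ \oo -->
    ((k == l)%:R / 2 : R)}.
  case: k l => [i b] [j b'] /=; have [[-> ->]|neq] := eqVneq.
    rewrite mul1r; apply: (slln_square indepX lawX (p := fun m => (m, j, b'))).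
    by move=> m n [].
  rewrite mul0r.
  apply: (slln_product indepX lawX (p := fun m => (m, i, b)) (q := fun m => (m, j, b'))).
    by move=> m; move: neq; apply: contra => /eqP[-> ->].
  (* The four indices differ by their row when m and n differ, and by sensor or component
     otherwise. *)
  move=> m n mn; rewrite /= !inE !xpair_eqE !eqxx (negbTE mn) /= ?orbF.
  by move: neq; rewrite xpair_eqE => ->.
have lim : {ae P, forall w, (fun M => cabs (g M w - L%:C)%C) @ \oo --> (0 : R)}.
  (* Finitely many pairs of indices, hence a single null set for all the averages. *)
  have : {ae P, forall w, forall k l : 'I_N * bool,
    (fun n => (\sum_(0 <= m < n) X (m, k.1, k.2) w * X (m, l.1, l.2) w) / n%:R) @ \oo -->
    ((k == l)%:R / 2 : R)}.
    by apply: filter_forall => k; apply: filter_forall => l; exact: slln.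
  apply: filterS => w Hw; apply: gH_cvg => //.
  - by move=> i j; have := Hw (i, true) (j, true); rewrite xpair_eqE andbT.
  - by move=> i j; have := Hw (i, false) (j, false); rewrite xpair_eqE andbT.
  - by move=> i j; have := Hw (i, true) (j, false); rewrite xpair_eqE andbF mul0r.
split => // eps /andP[eps0 _]; apply: filterS lim => w lim.
have cRe : (fun M => complex.Re (g M w)) @ \oo --> L.
  apply/subr_cvg0; apply: norm_cvg0; apply: (squeeze_cvgr _ (cvg_cst 0) lim).
  near=> M; rewrite normr_ge0/= -lecR -normr_cabs.
  by have := normc_ge_Re (g M w - L%:C)%C; case: (g M w) => x y /=.
have L0 : 0 <= L.
  apply: sumr_ge0 => i _; rewrite divr_ge0// addr_ge0 ?mulr_ge0 ?powR_ge0//; exact: ltW.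
(* For positive [eps] the power is exp(x ln eps), continuous in x; the inverse in the exponent is
   continuous at the limit since 1 + [sigth2] L > 0. *)
rewrite /powR gt_eqF//.
refine (cvg_comp (fun M => (1 + sigth2 * complex.Re (g M w))^-1 * ln eps) expR _ (@continuous_expR R _)).
apply: cvgMl.
apply: cvgV; first by rewrite gt_eqF// ltr_pwDl// mulr_ge0// ltW.
by apply: cvgD; [exact: cvg_cst|apply: cvgMr].
Unshelve. all: by end_near. Qed.
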